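(* Let $\hat f:\mathbb{R}^n\times\mathbb{R}^n\to\mathbb{R}^n$ and consider the vector field $Z:M\to TM$ on $M=\mathbb{R}^n\times\mathbb{R}^n$ given by $Z(x,e)=(\hat f(x,e),-\hat f(x,e))$, and a vector field $Y:N\to TN$ on a manifold $N$, giving rise to flows $\mathrm{z}$ and $\mathrm{y}$, respectively. Let $\eta_Z(x,e)=|e|/|x|$. If there exist maps $\varphi:M\to N$ and $\eta_Y:N\to\mathbb{R}$ such that 1. $T\varphi\, Z=Y\circ\varphi$; 2. $\eta_Y\circ\varphi=\eta_Z$, then, for every $z\in M$ and $c>0$, the inter-execution time $\tau_z(z)$ implicitly defined by $\eta_Z\circ\mathrm{z}(t,z)=c$ and the inter-execution time $\tau_y(\varphi(z))$ implicitly defined by $\eta_Y\circ\mathrm{y}(t,\varphi(z))=c$ coincide: $$\tau_z(z)=\tau_y(\varphi(z)).$$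
   Context: Vector fields and $\varphi$ are smooth; $|\cdot|$ is the Euclidean norm; $T\varphi$ denotes the differential of $\varphi$. The vector field $Z$ is the closed loop of a control system $\dot{\mathrm{x}}=f(\mathrm{x},\mathrm{u})$ under $u=k(x+e)$, with $\hat f(x,e)=f(x,k(x+e))$ and measurement error $\mathrm{e}$ satisfying $\dot{\mathrm{e}}=-\dot{\mathrm{x}}$. $\mathrm{z}(t,z)$ and $\mathrm{y}(t,y)$ denote the solutions at time $t$ of $\dot{\mathrm{z}}=Z(\mathrm{z})$ and $\dot{\mathrm{y}}=Y(\mathrm{y})$ with initial conditions $z$ and $y$; the flows are defined for all $t\in\mathbb{R}$. The output map $\eta_Z$ is defined at points with $x\ne 0$. Correspondingly, $\eta_Y$ may be only partially defined, and condition 2 is an equality of partially defined functions: $\eta_Y(\varphi(z))$ is defined exactly when $\eta_Z(z)$ is, and then they are equal. The inter-execution times are the first times $t\ge 0$ at which the respective equation $\eta_Z(\mathrm{z}(t,z))=c$, $\eta_Y(\mathrm{y}(t,\varphi(z)))=c$ holds (with value $+\infty$ if there is no such time). *)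

(* Defs.v *)
From HB Require Import structures.
From mathcomp Require Import all_boot all_order all_algebra.
From mathcomp Require Import all_classical all_reals all_analysis.

Set Implicit Arguments.
Unset Strict Implicit.
Unset Printing Implicit Defensive.

Import Order.TTheory GRing.Theory Num.Theory.
Import numFieldNormedType.Exports.

Local Open Scope classical_set_scope.
Local Open Scope ring_scope.

(* For V finite-dimensional and U open (the only uses below) this is the usual
   class C^k(U), phrased with iterated directional derivatives.  The values of
   f outside U are irrelevant. *)
Fixpoint Ck_on (R : realType) (V W : normedModType R) (k : nat)
    (U : set V) (f : V -> W) : Prop :=
  match k with
  | 0%N => forall x, U x -> {for x, continuous f}
  | k'.+1 => (forall x, U x -> differentiable f x) /\
             (forall v : V, Ck_on k' U (fun x => 'D_v f x))
  end.

Definition smooth_on (R : realType) (V W : normedModType R)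
    (U : set V) (f : V -> W) : Prop :=
  forall k, Ck_on k U f.

(* Charts are total functions whose values matter only on cdom (for cmap) and
   on cimg (for cinv). *)
Record chart (R : realType) (N : topologicalType) (m : nat) := Chart {
  cdom : set N;
  cmap :> N -> 'rV[R]_m;
  cinv : 'rV[R]_m -> N;
  cdom_open : open cdom;
  cimg_open : open (cmap @` cdom);
  cmapK : forall p, cdom p -> cinv (cmap p) = p;
  cmap_continuous : forall p, cdom p -> {for p, continuous cmap};
  cinv_continuous : forall u, (cmap @` cdom) u -> {for u, continuous cinv}
}.

Definition cimg (R : realType) (N : topologicalType) (m : nat)
  (c : chart R N m) : set 'rV[R]_m := c @` cdom c.

Definition transition (R : realType) (N : topologicalType) (m : nat)
  (c d : chart R N m) : 'rV[R]_m -> 'rV[R]_m := d \o cinv c.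

Record manifold (R : realType) (m : nat) := Manifold {
  mcarrier :> topologicalType;
  mhausdorff : hausdorff_space mcarrier;
  msecond_countable : @second_countable mcarrier;
  atlas : set (chart R mcarrier m);
  atlas_cover : forall p, exists2 c, atlas c & cdom c p;
  atlas_smooth : forall c d, atlas c -> atlas d ->
    smooth_on (c @` (cdom c `&` cdom d)) (transition c d)
}.

Record chart_at (R : realType) (m : nat) (N : manifold R m) (p : N) :=
  ChartAt {
    chart_of :> chart R N m;
    chart_atlas : atlas chart_of;
    chart_dom : cdom chart_of p
  }.

(* A tangent vector at p, as the family of its coordinates in all the charts
   around p, related by the differentials of the transition maps. *)
Record tangent (R : realType) (m : nat) (N : manifold R m) (p : N) :=
  Tangent {
    coord : chart_at p -> 'rV[R]_m;
    coord_compat : forall c d : chart_at p,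
      coord d = 'd (transition c d) (c p) (coord c)
  }.

(* The function g is the expression of the vector field in the chart c. *)
Record vector_field (R : realType) (m : nat) (N : manifold R m) :=
  VectorField {
    vfield :> forall p : N, tangent p;
    vfield_smooth : forall c : chart R N m, atlas c ->
      exists2 g : 'rV[R]_m -> 'rV[R]_m, smooth_on (cimg c) g &
        forall p (ca : atlas c) (cp : cdom c p),
          coord (vfield p) (ChartAt ca cp) = g (c p)
  }.

Record smooth_map (R : realType) (m : nat) (V : normedModType R)
    (N : manifold R m) := SmoothMap {
  smap :> V -> N;
  smap_continuous : continuous smap;
  smap_smooth : forall c : chart R N m, atlas c ->
    smooth_on (smap @^-1` cdom c) (c \o smap)
}.

Lemma smap_differentiable (R : realType) (m : nat) (V : normedModType R)
    (N : manifold R m) (phi : smooth_map V N) (x : V)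
    (c : chart_at (phi x)) : differentiable (c \o phi) x.
Proof.
by have [+ _] := smap_smooth phi (chart_atlas c) 1; apply; exact: chart_dom.
Qed.

Lemma tangent_map_compat (R : realType) (m : nat) (V : normedModType R)
    (N : manifold R m) (phi : smooth_map V N) (x v : V)
    (c d : chart_at (phi x)) :
  'd (d \o phi) x v = 'd (transition c d) (c (phi x)) ('d (c \o phi) x v).
Proof.
have dtr : differentiable (transition c d) ((c \o phi) x).
  have [+ _] := atlas_smooth (chart_atlas c) (chart_atlas d) 1; apply.
  by exists (phi x) => //; split; exact: chart_dom.
have dc := smap_differentiable c.
have E := congr1 (fun f => f v) (diff_comp dc dtr).
have Ed := deriveE v (smap_differentiable d).
have Ecd := deriveE v (differentiable_comp dc dtr).
refine (etrans (esym Ed) (etrans _ (etrans Ecd E))).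
apply: near_eq_derive.
have nc : nbhs (phi x) (cdom c).
  by apply: open_nbhs_nbhs; split; [exact: cdom_open | exact: chart_dom].
near=> y; rewrite /transition /= cmapK//; near: y.
exact: (smap_continuous (s := phi) (x := x) nc).
Unshelve. all: by end_near. Qed.

(* T phi at the point x, applied to the vector v. *)
Definition tangent_map (R : realType) (m : nat) (V : normedModType R)
    (N : manifold R m) (phi : smooth_map V N) (x v : V) : tangent (phi x) :=
  @Tangent R m N (phi x) (fun c => 'd (c \o phi) x v)
    (tangent_map_compat (phi := phi) v).

Definition is_flow (R : realType) (m : nat) (N : manifold R m)
    (Y : vector_field N) (y : R -> N -> N) : Prop :=
  forall p : N, [/\ y 0 p = p,
    continuous (fun t => y t p) &
    forall (t : R) (c : chart_at (y t p)),
      is_derive t 1 (fun s => c (y s p)) (coord (Y (y t p)) c)].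

(* The same notion on a vector space, with its tangent bundle trivialized. *)
Definition is_flow_vect (R : realType) (V : normedModType R)
    (Z : V -> V) (z : R -> V -> V) : Prop :=
  forall p : V, z 0 p = p /\
    forall t : R, is_derive t 1 (fun s => z s p) (Z (z t p)).

Definition phase_space (R : realType) (n : nat) : normedModType R :=
  ('rV[R]_n * 'rV[R]_n)%type.

Definition closed_loop (R : realType) (n : nat)
    (fhat : phase_space R n -> 'rV[R]_n) (p : phase_space R n) :
    phase_space R n :=
  (fhat p, - fhat p).

(* `|x| on 'rV[R]_n is the sup norm, hence this definition. *)
Definition eucl_norm (R : realType) (n : nat) (x : 'rV[R]_n) : R :=
  Num.sqrt (\sum_(i < n) x 0 i ^+ 2).

(* Partially defined real functions are option-valued. *)
Definition eta_Z (R : realType) (n : nat) (p : phase_space R n) : option R :=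
  if p.1 == 0 then None else Some (eucl_norm p.2 / eucl_norm p.1).

(* The least element of S, or +oo if S is empty.  It is undefined (None) if S is
   nonempty without a least element; this can happen for the times below, as
   eta_Z is not defined everywhere. *)
Definition first_time (R : realType) (S : set R) : option (\bar R) :=
  let tau := ereal_inf (EFin @` S) in
  if `[< S = set0 \/ exists2 t, S t & tau = t%:E >] then Some tau else None.

Definition inter_execution_time (R : realType) (T : Type)
    (eta : T -> option R) (flow : R -> T -> T) (c : R) (p : T) :
    option (\bar R) :=
  first_time [set t | 0 <= t /\ eta (flow t p) = Some c].

(* Main.v *)
(** The image under [phi] of an integral curve of [Z] is an integral curve of
    [Y], so uniqueness of integral curves gives [phi (z t p) = y t (phi p)] for
    all [t]; the two sets of candidate times are then equal because [eta_Y]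
    composed with [phi] is [eta_Z].

    For uniqueness, the set of times at which two integral curves of [Y] agree
    is closed since the manifold is Hausdorff, and open since in a chart [Y] is
    C^1, hence locally Lipschitz; as [R] is connected, it is everything. *)
Require Import Defs.
From HB Require Import structures.
From mathcomp Require Import all_boot all_order all_algebra.
From mathcomp Require Import all_classical all_reals all_analysis.
From mathcomp Require Import ring lra.

Set Implicit Arguments.
Unset Strict Implicit.
Unset Printing Implicit Defensive.

Import Order.TTheory GRing.Theory Num.Theory.
Import numFieldNormedType.Exports.

Local Open Scope classical_set_scope.
Local Open Scope ring_scope.

Lemma ler_coord_norm (R : realFieldType) (n : nat) (x : 'rV[R]_n) (i : 'I_n) :
  `|x 0 i| <= `|x|.
Proof.
rewrite [leRHS]/Num.norm/= mx_normrE.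
exact: (le_bigmax _ (fun ij : 'I_1 * 'I_n => `|x ij.1 ij.2|) (0, i)).
Qed.

Lemma row_norm_le (R : realFieldType) (n : nat) (x : 'rV[R]_n) (e : R) :
  0 <= e -> (forall i, `|x 0 i| <= e) -> `|x| <= e.
Proof.
move=> e0 xe; rewrite [leLHS]/Num.norm/= mx_normrE bigmax_le//= => -[i j] _.
by rewrite (ord1 i); exact: xe.
Qed.

Lemma is_derive_coord (R : realType) (V : normedModType R) (n : nat)
    (f : V -> 'rV[R]_n) (df : 'rV[R]_n) (t v : V) (i : 'I_n) :
  is_derive t v f df -> is_derive t v (fun s => f s 0 i) (df 0 i).
Proof.
move=> [dvf <-]; split; first by have /derivable_mxP := dvf; exact.
by rewrite derive_mx// mxE.
Qed.

Lemma is_derive1_diff_comp (R : realType) (V W : normedModType R)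
    (f : R -> V) (g : V -> W) (t : R) (df : V) :
  is_derive t 1 f df -> differentiable g (f t) ->
  is_derive t 1 (g \o f) ('d g (f t) df).
Proof.
move=> [/derivable1_diffP dft <-] dg.
have dgf : differentiable (g \o f) t by exact: differentiable_comp.
split; first exact/derivable1_diffP.
by rewrite !deriveE// diff_comp.
Qed.

(** The scalar mean value theorem is applied to each coordinate. As the norm on row vectors is the
    sup norm, the coordinatewise bounds recombine with the same [K]. *)
Lemma mean_value_norm_le (R : realType) (n : nat) (f df : R -> 'rV[R]_n)
    (a b K : R) :
  {in `[a, b], forall t : R, is_derive t 1 f (df t)} ->
  {in `[a, b], forall t, `|df t| <= K} ->
  {in `[a, b] &, forall s t, `|f t - f s| <= K * `|t - s|}.
Proof.
move=> fdf dfK s t; wlog st : s t / s <= t.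
  move=> H sab tab; have [st|/ltW ts] := leP s t; first exact: H.
  by rewrite distrC (distrC t); exact: H.
move=> sab tab; have K0 : 0 <= K := le_trans (normr_ge0 _) (dfK s sab).
have sub x : x \in `[s, t] -> x \in `[a, b].
  move: sab tab; rewrite !in_itv/= => /andP[as_ _] /andP[_ tb] /andP[sx xt].
  by rewrite (le_trans as_ sx) (le_trans xt tb).
apply: row_norm_le => [|i]; first by rewrite mulr_ge0.
pose h (u : R) : R := f u 0 i; pose dh (u : R) : R := df u 0 i.
have dfi x : x \in `[s, t] -> is_derive x 1 h (dh x).
  by move=> /sub /fdf; exact: is_derive_coord.
have dfo x : x \in `]s, t[ -> is_derive x 1 h (dh x).
  by move=> /subset_itv_oo_cc; exact: dfi.
have ch : {within `[s, t], continuous h}.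
  by apply: derivable_within_continuous => x /dfi [].
have [c cst hE] := MVT_segment st dfo ch.
rewrite !mxE -/(h t) -/(h s) hE normrM ler_wpM2r//.
by apply: le_trans (dfK c (sub _ cst)); exact: ler_coord_norm.
Qed.

(** Continuity of the partial derivatives bounds the differential on a ball around [x0]. Balls are
    convex, so the mean value inequality applies along the segment from [y] to [x]. *)
Lemma C1_locally_lipschitz (R : realType) (m n : nat) (U : set 'rV[R]_m)
    (g : 'rV[R]_m -> 'rV[R]_n) (x0 : 'rV[R]_m) :
  open U -> U x0 -> Ck_on 1 U g ->
  exists K : R, exists2 e, 0 < e &
    forall x y, ball x0 e x -> ball x0 e y -> `|g x - g y| <= K * `|x - y|.
Proof.
move=> oU Ux0 [dg cg].
(* The margin 1 in each term absorbs the variation of that partial derivative near [x0]. Expanding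
   [v] in the standard basis, with [|v 0 j| <= |v|], makes [K] a bound on the operator norm of
   ['d g p]. *)
pose K := \sum_(j < m) (`|'D_('e_j) g x0| + 1).
have near_bound : \forall p \near x0,
    U p /\ forall j : 'I_m, `|'D_('e_j) g p| <= `|'D_('e_j) g x0| + 1.
  near=> p; split; first by near: p; exact: open_nbhs_nbhs.
  near: p; apply: filter_forall => j.
  near=> p; apply/ltW; near: p.
  by apply: cvgr_norm_lt (cg 'e_j x0 Ux0) _ _; rewrite ltrDl.
have [e /= e0 eP] := (nbhs_ballP _ _).1 near_bound.
exists K; exists e => // x y xe ye.
have dgK p v : ball x0 e p -> `|'d g p v| <= K * `|v|.
  move=> /eP[Up bp]; rewrite [in leLHS](row_sum_delta v) linear_sum mulr_suml.
  apply: le_trans (ler_norm_sum _ _ _) _; apply: ler_sum => j _.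
  rewrite linearZ normrZ mulrC -deriveE; last exact: dg.
  by apply: ler_pM => //; exact: ler_coord_norm.
pose l (t : R) : 'rV[R]_m := t *: (x - y) + y.
have le t : t \in `[0, 1] -> ball x0 e (l t).
  rewrite in_itv/= => /andP[t0 t1].
  have -> : l t = t *: x + (1 - t) *: y.
    by rewrite /l scalerBr scalerBl scale1r -addrA addrC (addrC (- _)) addrC.
  rewrite -ball_normE /ball_/=.
  have -> : x0 - (t *: x + (1 - t) *: y) = t *: (x0 - x) + (1 - t) *: (x0 - y).
    by rewrite !scalerBr addrACA -scalerDl [t + _]addrC subrK scale1r opprD.
  have t10 : 0 <= 1 - t by rewrite subr_ge0.
  move: xe ye; rewrite -ball_normE /ball_/= => xe ye.
  apply: le_lt_trans (ler_normD _ _) _; rewrite !normrZ !ger0_norm//.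
  (* Strictness will come from the term in [x], which needs [0 < t]; for [t = 0] the point is [y]
     itself. *)
  move: t0; rewrite le_eqVlt => /predU1P[<-|t0].
    by rewrite mul0r add0r subr0 mul1r.
  rewrite [ltRHS](_ : e = t * e + (1 - t) * e); last first.
    by ring.
  apply: ltr_leD; first by rewrite ltr_pM2l.
  by rewrite ler_wpM2l// ltW.
have dl t : is_derive t (1 : R) l (x - y).
  have dlt : is_diff t l (( *:%R^~ (x - y)) + 0 : R -> 'rV[R]_m).
    exact: (is_diffD (is_diff_scalel t (x - y)) (is_diff_cst y t)).
  split; first exact/derivable1_diffP.
  by rewrite deriveE// diff_val /= fctE addr0 scale1r.
have dgl : {in `[0, 1], forall t : R,
    is_derive t 1 (g \o l) ('d g (l t) (x - y))}.
  by move=> t /le/eP[Ult _]; apply: is_derive1_diff_comp; exact: dg.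
have := @mean_value_norm_le _ _ (g \o l) _ 0 1 (K * `|x - y|) dgl.
move=> /(_ _ 0 1); rewrite /= /l scale1r scale0r add0r subrK subr0 normr1 mulr1.
apply; rewrite ?in_itv/= ?lexx ?ler01//.
by move=> t /le; exact: dgK.
Unshelve. all: by end_near. Qed.

Lemma local_ode_unique (R : realType) (n : nat) (g : 'rV[R]_n -> 'rV[R]_n)
    (u v : R -> 'rV[R]_n) (t0 K : R) :
  (\forall t \near t0, is_derive (t : R) 1 u (g (u t))) ->
  (\forall t \near t0, is_derive (t : R) 1 v (g (v t))) ->
  (\forall t \near t0, `|g (u t) - g (v t)| <= K * `|u t - v t|) ->
  u t0 = v t0 -> \forall t \near t0, u t = v t.
Proof.
move=> du dv gK uv0.
have [e /= e0 eP] := (nbhs_ballP _ _).1 (filterI du (filterI dv gK)).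
(* [K] may be zero or negative, so [|K| + 1] replaces it as a positive Lipschitz constant. *)
have K1 : 0 < `|K| + 1 by rewrite ltr_wpDl.
(* The bound [e / 2] keeps the closed interval [[a, b]] inside the open ball of radius [e]; the
   other one makes [(|K| + 1) * d] at most one half. *)
pose d := Num.min (e / 2) (2^-1 / (`|K| + 1)).
have d0 : 0 < d by rewrite lt_min !divr_gt0//.
have dK : (`|K| + 1) * d <= 2^-1.
  by rewrite mulrC -ler_pdivlMr// ge_min lexx orbT.
pose a := t0 - d; pose b := t0 + d; pose w := u - v.
have abP t : t \in `[a, b] -> `|t - t0| <= d by rewrite in_itv/= ler_distl.
have abE t : t \in `[a, b] -> ball t0 e t.
  move=> /abP td; rewrite -ball_normE /ball_/= distrC (le_lt_trans td)//.
  by rewrite gt_min ltr_pdivrMr// ltr_pMr// ltr1n.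
have t0ab : t0 \in `[a, b] by rewrite in_itv/= -ler_distl subrr normr0 ltW.
have dw : {in `[a, b], forall t : R, is_derive t 1 w (g (u t) - g (v t))}.
  by move=> t /abE/eP[ut [vt _]]; exact: is_deriveB.
have cw : {within `[a, b], continuous (fun t => `|w t|)}.
  have cw : {within `[a, b], continuous w}.
    by apply: derivable_within_continuous => t /dw [].
  by move=> t; exact: (cvg_norm (cw t)).
have ab : a <= b by rewrite lerD2l ge0_cp// ltW.
have [c cab cmax] := EVT_max ab cw.
(* The mean value inequality between [t0] and the maximum point [c] of [`|w|]
   gives [`|w c| <= `|w c| / 2], by the choice of [d]. *)
have wc0 : `|w c| <= 0.
  have dwK : {in `[a, b], forall t,
      `|g (u t) - g (v t)| <= (`|K| + 1) * `|w c|}.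
    move=> t tab; have [_ [_ /le_trans]] := eP _ (abE _ tab); apply.
    apply: (@le_trans _ _ ((`|K| + 1) * `|w t|)).
      by rewrite ler_wpM2r// (le_trans (ler_norm K))// lerDl.
    by rewrite ler_pM2l//; exact: cmax.
  have := mean_value_norm_le dw dwK t0ab cab.
  have -> : w t0 = 0 by rewrite /w fctE uv0 subrr.
  rewrite subr0 mulrAC => wcK.
  suff : (`|K| + 1) * `|c - t0| * `|w c| <= 2^-1 * `|w c| by lra.
  rewrite ler_wpM2r//; apply: le_trans dK.
  by rewrite ler_pM2l//; exact: abP.
apply/nbhs_ballP; exists d => //= t; rewrite -ball_normE /ball_/= distrC => td.
apply/eqP; rewrite -subr_eq0 -normr_le0; apply: le_trans wc0.
by apply: cmax; rewrite in_itv/= -ler_distl ltW.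
Qed.

Lemma eq_of_locally_eq (R : realType) (N : topologicalType) (a b : R -> N)
    (t0 : R) :
  hausdorff_space N -> continuous a -> continuous b -> a t0 = b t0 ->
  (forall t, a t = b t -> \forall s \near t, a s = b s) -> a = b.
Proof.
move=> hN ca cb ab0 abn; apply/funext => t.
have RC : connected [set: R] by apply/connected_intervalP.
have E : [set t | a t = b t] = setT.
  apply: RC; first by exists t0.
  - exists [set t | a t = b t]; last by rewrite setTI.
    by rewrite openE => s /abn.
  - exists [set t | a t = b t]; last by rewrite setTI.
    (* Neighbourhoods of [a s] and [b s] always meet: for an agreement time [r] close to [s], the
       point [a r = b r] lies in both. *)
    move=> s sE; apply: hN => A B As Bs.
    have nA : nbhs s (a @^-1` A) := ca s _ As.
    have nB : nbhs s (b @^-1` B) := cb s _ Bs.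
    have [r [rE [rA rB]]] := sE _ (filterI nA nB).
    by exists (a r); split => //; rewrite rE.
by have : [set t | a t = b t] t by rewrite E.
Qed.

(** The condition that [is_flow] puts on a single orbit, freed from the initial value so that it
    also makes sense for images under [phi]. *)
Definition integral_curve (R : realType) (m : nat) (N : manifold R m)
    (Y : vector_field N) (a : R -> N) : Prop :=
  continuous a /\ forall (t : R) (c : chart_at (a t)),
    is_derive t 1 (fun s => c (a s)) (Defs.coord (Y (a t)) c).

(** Near an agreement time both curves stay in one chart, inside a ball where the coordinate
    expression [g] of [Y] is Lipschitz. Local uniqueness there passes back to the manifold since
    charts are injective on their domains. *)
Lemma integral_curve_unique (R : realType) (m : nat) (N : manifold R m)
    (Y : vector_field N) (a b : R -> N) (t0 : R) :
  integral_curve Y a -> integral_curve Y b -> a t0 = b t0 -> a = b.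
Proof.
move=> [ca da] [cb db] ab0.
apply: (eq_of_locally_eq (@mhausdorff _ _ N) ca cb ab0) => t abt.
have [c ac cat] := atlas_cover (a t).
have [g sg gY] := vfield_smooth Y ac.
have [K [e e0 gK]] : exists K : R, exists2 e, 0 < e & forall x y,
    ball (c (a t)) e x -> ball (c (a t)) e y -> `|g x - g y| <= K * `|x - y|.
  apply: (@C1_locally_lipschitz _ _ _ (cimg c)); last exact: (sg 1).
  - exact: cimg_open.
  - by exists (a t).
have nearc (f : R -> N) : continuous f -> f t = a t -> \forall s \near t,
    cdom c (f s) /\ ball (c (a t)) e (c (f s)).
  move=> cf fa; suff H : nbhs (f t) (cdom c `&` c @^-1` ball (c (a t)) e).
    exact: (cf t _ H).
  rewrite fa; apply: filterI.
    by apply: open_nbhs_nbhs; split; [exact: cdom_open | exact: cat].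
  exact: (cmap_continuous cat (nbhsx_ballx _ _ e0)).
have na := nearc _ ca erefl.
have nb := nearc _ cb (esym abt).
have ncab : \forall s \near t, c (a s) = c (b s).
  apply: (@local_ode_unique _ _ g (fun s => c (a s)) (fun s => c (b s)) t K).
  - apply: filterS na => s [cas _].
    (* [chart_at] depends on the base point, so [c] is repackaged at each [a s]. *)
    by rewrite -(gY _ ac cas); exact: (da s (ChartAt ac cas)).
  - apply: filterS nb => s [cbs _].
    by rewrite -(gY _ ac cbs); exact: (db s (ChartAt ac cbs)).
  - by apply: filterS2 na nb => s [_ ba] [_ bb]; exact: gK.
  - by rewrite abt.
apply: filterS3 na nb ncab => s [cas _] [cbs _] cab.
by rewrite -(cmapK cas) cab cmapK.
Qed.

(** By the chain rule, the velocity in a chart [c] is ['d (c \o phi)] applied to [Z]. This is by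
    definition the coordinate of [tangent_map] in [c], hence that of [Y]. *)
Lemma integral_curve_image (R : realType) (m : nat) (V : normedModType R)
    (Z : V -> V) (N : manifold R m) (Y : vector_field N) (phi : smooth_map V N)
    (a : R -> V) :
  (forall p, tangent_map phi p (Z p) = Y (phi p)) ->
  (forall t : R, is_derive t 1 a (Z (a t))) ->
  integral_curve Y (phi \o a).
Proof.
move=> phiZ da; split=> [t|t c].
  apply: continuous_comp; last exact: smap_continuous.
  by apply: differentiable_continuous; apply/derivable1_diffP; case: (da t).
rewrite -phiZ; apply: (@is_derive1_diff_comp _ _ _ a (c \o phi) _ _ (da t)).
exact: smap_differentiable.
Qed.

Theorem theorem5p1 (R : realType) (n m : nat)
    (fhat : phase_space R n -> 'rV[R]_n)
    (Z_smooth : smooth_on setT (closed_loop fhat))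
    (z : R -> phase_space R n -> phase_space R n)
    (z_flow : is_flow_vect (closed_loop fhat) z)
    (N : manifold R m) (Y : vector_field N)
    (y : R -> N -> N) (y_flow : is_flow Y y)
    (phi : smooth_map (phase_space R n) N) (eta_Y : N -> option R)
    (phi_related : forall p : phase_space R n,
       tangent_map phi p (closed_loop fhat p) = Y (phi p))
    (eta_related : forall p : phase_space R n, eta_Y (phi p) = eta_Z p) :
  forall (p : phase_space R n) (c : R), 0 < c ->
    inter_execution_time (@eta_Z R n) z c p =
    inter_execution_time eta_Y y c (phi p).
Proof.
(* Equality of the two sets of times also settles the values [+oo] and [None] of [first_time]. *)
move=> p c _; congr first_time; apply/funext => t /=.
suff E : phi \o z ^~ p = y ^~ (phi p).
  by rewrite -eta_related -[phi (z t p)]/((phi \o z ^~ p) t) E.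
have [z0 dz] := z_flow p; have [y0 cy dy] := y_flow (phi p).
apply: (@integral_curve_unique _ _ _ Y _ _ 0).
- by apply: integral_curve_image dz; exact: phi_related.
- by split.
- by rewrite /= z0 y0.
Qed.
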